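(* For each $\nu\ge 1$ let $n_\nu\ge1$ be an integer and let $d_1^{(\nu)},\dots,d_{n_\nu}^{(\nu)}$ be non-negative integers with even sum. Let $G^*_\nu = G^*\bigl(n_\nu,(d_i^{(\nu)})_{i=1}^{n_\nu}\bigr)$ be the random multigraph given by the configuration model, and let $N_\nu=\tfrac12\sum_{i} d_i^{(\nu)}$ be its number of edges. Assume that $N_\nu\to\infty$ as $\nu\to\infty$. Then: (i) $\liminf_{\nu\to\infty}\mathbb P(G^*_\nu\text{ is simple})>0$ if and only if $\sum_i (d_i^{(\nu)})^2=O(N_\nu)$ as $\nu\to\infty$; (ii) $\lim_{\nu\to\infty}\mathbb P(G^*_\nu\text{ is simple})=0$ if and only if $\sum_i (d_i^{(\nu)})^2/N_\nu\to\infty$ as $\nu\to\infty$.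
   Context: Configuration model: given $n\ge1$ and non-negative integers $d_1,\dots,d_n$ with $\sum_i d_i=2N$ even, take pairwise disjoint sets of half-edges, with $d_v$ half-edges belonging to each vertex $v\in\{1,\dots,n\}$ ($2N$ half-edges in total). A configuration is a partition of the set of all half-edges into $N$ pairs. Choose a configuration uniformly at random; $G^*(n,(d_i)_1^n)$ is the random multigraph with vertex set $\{1,\dots,n\}$ in which each pair $\{x,y\}$ of the configuration, with $x$ belonging to $v$ and $y$ belonging to $w$, gives an edge between $v$ and $w$ (a loop if $v=w$). A multigraph is simple if it has no loops and no multiple edges. *)

(* Defs.v *)
From HB Require Import structures.
From mathcomp Require Import all_boot all_order all_algebra.
From mathcomp Require Import all_classical all_reals all_analysis.

Set Implicit Arguments.
Unset Strict Implicit.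
Unset Printing Implicit Defensive.

Import Order.TTheory GRing.Theory Num.Theory.

(* [mult v w] is the number of edges between v and w; [mult v v] is the number
   of loops at v. *)
Record multigraph (V : Type) := Multigraph {
  mult : V -> V -> nat;
  multC : forall v w, mult v w = mult w v
}.

Definition simple (V : finType) (G : multigraph V) : bool :=
  [forall v, mult G v v == 0] && [forall v, forall w, mult G v w <= 1].

Section ConfigurationModel.
Variables (n : nat) (d : 'I_n -> nat).

(* The half-edge [Tagged _ i] with tag v is the i-th half-edge of v. *)
Definition half_edge : finType := {v : 'I_n & 'I_(d v)}.

Definition vertex_of (x : half_edge) : 'I_n := tag x.

Definition num_edges : nat := (\sum_(v < n) d v)./2.

Definition configurations : {set {set {set half_edge}}} :=
  [set c | finset.partition c [set: half_edge] & [forall p in c, #|p| == 2]].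

(* For p = {x, y}, the equality below says that {x, y} joins v and w, in either
   order. *)
Definition config_mult (c : {set {set half_edge}}) (v w : 'I_n) : nat :=
  #|[set p in c | [set vertex_of x | x in p] == [set v; w]]|.

Lemma config_multC c v w : config_mult c v w = config_mult c w v.
Proof. by rewrite /config_mult (finset.setUC [set v]). Qed.

Definition config_graph (c : {set {set half_edge}}) : multigraph 'I_n :=
  Multigraph (config_multC c).

(* Probability that G^*(n, d) has the property Q, for a configuration drawn
   uniformly at random. *)
Definition Pr_Gstar (R : realType) (Q : pred (multigraph 'I_n)) : R :=
  (#|[set c in configurations | Q (config_graph c)]|%:R
     / #|configurations|%:R)%R.

End ConfigurationModel.

(* Main.v *)
Require Import Defs.
From HB Require Import structures.
From mathcomp Require Import all_boot all_order all_algebra.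
From mathcomp Require Import all_classical all_reals all_analysis.
From mathcomp Require Import perm zify.

Set Implicit Arguments.
Unset Strict Implicit.
Unset Printing Implicit Defensive.

Import Order.TTheory GRing.Theory Num.Theory.
Import numFieldNormedType.Exports.
Import mathcomp.boot.fintype mathcomp.boot.finset.

(** Write [N] for the number of edges and [S] for the sum of the squared
    degrees. Everything follows from two bounds on the probability of being
    simple which depend on the degree sequence only through [N] and [S]: it is
    at most [1/m] if [N >= 4m] and [S >= (8m + 2) N] ([Pr_simple_le]), and it is
    at least some [e(C) > 0] if [S <= C N] and [N] is large
    ([Pr_simple_ge]). Both parts of the theorem are formal consequences.

    Upper bound. Loops alone suffice. A given half-edge has each other half-edge
    as its partner with probability [1 / (2N - 1)], and two disjoint pairs are
    joined with probability at most [1 / ((2N - 1)(2N - 3))]; so when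
    [N] and [S / N] are large, the mean number of loops is large, its variance
    is small compared with the square of the mean, and Chebyshev's inequality
    bounds the probability that there is no loop ([loopless_upper]).

    Lower bound. This is a switching argument. Call a half-edge bad if its edge
    is a loop or has a parallel edge; by the same first and second moments, the
    expected number of bad half-edges is bounded in terms of [C]. Take a bad
    half-edge [a] and any other half-edge [b], with partners [x] and [y], and
    replace the edges [ax], [by] by [ay], [bx]; this is the action on
    configurations of the transposition [(a b)]. When [N] is large and few
    half-edges are bad, for at least [N] of the [2N] choices of [b] the two new
    edges are neither loops nor parallel to any edge ([card_switchable]), and
    then fewer half-edges are bad ([num_bad_switch]).
    Conversely, to recover the old configuration from the new one, [a] and [x]
    must be chosen either at the same vertex or at the two ends of an existing
    edge, which leaves at most [S + Q] possibilities, where [Q] is the sum, over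
    the half-edges [k], of the product of the degrees at the two ends of the
    edge of [k] ([reaches_count]). Since [Q] is of order [N] on average but not
    always, only configurations with a bounded [potential] are used; this
    potential controls both [Q] and the number of bad half-edges, is O(N) in
    expectation, and does not increase under the switchings considered. Among
    these configurations, lowering the maximal number of bad half-edges by one
    therefore costs only a constant factor ([tame_step]), and a bounded number
    of steps leads to the simple ones ([good_lower]). *)

(** * Finite sums *)

Lemma card_sum_bool (T : finType) (P : pred T) : #|[set x | P x]| = \sum_x P x.
Proof. by rewrite -sum1dep_card big_mkcond; apply: eq_bigr => x _; case: (P x). Qed.

(** The Cauchy-Schwarz inequality against the constant function 1. *)
Lemma sqr_sum_le (T : finType) (W : {set T}) (f : T -> nat) :
  (\sum_(i in W) f i) ^ 2 <= #|W| * \sum_(i in W) f i ^ 2.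
Proof.
rewrite -(leq_pmul2l (isT : 0 < 2)).
have -> : 2 * (#|W| * \sum_(i in W) f i ^ 2)
          = \sum_(i in W) \sum_(j in W) (f i ^ 2 + f j ^ 2).
  under [RHS]eq_bigr do rewrite big_split /= sum_nat_const.
  by rewrite big_split /= -big_distrr /= sum_nat_const mul2n addnn.
rewrite expnS expn1 !big_distrl /= big_distrr /=; apply: leq_sum => i _.
rewrite !big_distrr /=; apply: leq_sum => j _.
by have [] := nat_Cauchy (f i) (f j).
Qed.

(** * Random pairings of a finite set *)

(** Locked so that membership rewriting does not unfold it. *)
HB.lock Definition pairings (H : finType) : {set {set {set H}}} :=
  [set c | partition c [set: H] & [forall p in c, #|p| == 2]].

Section Pairings.
Variable H : finType.
Local Notation pairings := (pairings H).
Implicit Types (c : {set {set H}}) (a b x y : H).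

(** The default value [x] is never used when [c] is a pairing; see
    [partner_neq]. *)
Definition partner c x : H := odflt x [pick y in pblock c x | y != x].

Lemma pair_partner c p x : c \in pairings -> p \in c -> x \in p ->
  (partner c x != x) /\ p = [set x; partner c x].
Proof.
rewrite pairings.unlock inE => /andP[/and3P[_ tI _] /forall_inP card2] pc xp.
rewrite /partner (def_pblock tI pc xp).
have /cards2P[u [v [uv pE]]] := card2 _ pc.
case: pickP => [y /= /andP[yp yx] | /= no]; last first.
  move: xp; rewrite pE !inE => /orP[]/eqP xE.
    by have:= no v; rewrite pE !inE eqxx orbT /= xE eq_sym uv.
  by have:= no u; rewrite pE !inE eqxx /= xE uv.
split=> //; apply/eqP; rewrite eq_sym eqEcard (eqP (card2 _ pc)).
rewrite cards2 eq_sym yx andbT; apply/subsetP => z.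
by rewrite !inE => /orP[]/eqP->.
Qed.

Lemma pairing_cover c x : c \in pairings -> exists2 p, p \in c & x \in p.
Proof.
rewrite pairings.unlock inE => /andP[/and3P[/eqP cov _ _] _].
have xc : x \in cover c by rewrite cov inE.
by exists (pblock c x); [exact: pblock_mem | rewrite mem_pblock].
Qed.

Lemma partner_neq c x : c \in pairings -> partner c x != x.
Proof.
by move=> cP; have [p pc /(pair_partner cP pc)[]] := pairing_cover x cP.
Qed.

Lemma partner_mem c x : c \in pairings -> [set x; partner c x] \in c.
Proof.
move=> cP; have [p pc xp] := pairing_cover x cP.
by have [_ <-] := pair_partner cP pc xp.
Qed.

Lemma partner_uniq c x y :
  c \in pairings -> [set x; y] \in c -> x != y -> partner c x = y.
Proof.
move=> cP xyc xy; have [_ E] := pair_partner cP xyc (set21 x y).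
have := set22 x y; rewrite E !inE eq_sym (negbTE xy) => /= /eqP->.
by [].
Qed.

Lemma partnerK c : c \in pairings -> involutive (partner c).
Proof.
move=> cP x; apply: partner_uniq; rewrite ?partner_neq //.
by rewrite setUC partner_mem.
Qed.

Lemma partner_inj c : c \in pairings -> injective (partner c).
Proof. by move=> cP; apply/inv_inj/partnerK. Qed.

(** The switching of the pairs of [a] and [b]: these two half-edges exchange
    their partners. *)
Definition swap a b c : {set {set H}} := [set tperm a b @: (p : {set H}) | p in c].

Lemma swapK a b : involutive (swap a b).
Proof.
move=> c; rewrite /swap -imset_comp -[RHS]imset_id; apply: eq_imset => p /=.
by rewrite -imset_comp -[RHS]imset_id; apply: eq_imset => x /=; rewrite tpermK.
Qed.

Lemma swap_pairings a b c : c \in pairings -> swap a b c \in pairings.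
Proof.
rewrite pairings.unlock !inE => /andP[cP /forall_inP card2]; apply/andP; split.
  have -> : [set: H] = tperm a b @: [set: H].
    apply/setP=> x; rewrite inE; apply/esym/imsetP.
    by exists (tperm a b x); rewrite ?inE // tpermK.
  by rewrite imset_partition //; apply: perm_inj.
apply/forall_inP => _ /imsetP[p pc ->].
by rewrite card_imset ?card2 //; apply: perm_inj.
Qed.

Lemma partner_swap a b c x : c \in pairings ->
  partner (swap a b c) x = tperm a b (partner c (tperm a b x)).
Proof.
move=> cP; apply: partner_uniq; first exact: swap_pairings.
  apply/imsetP; exists [set tperm a b x; partner c (tperm a b x)].
    exact: partner_mem.
  by rewrite imsetU1 imset_set1 tpermK.
by rewrite -{1}[x](tpermK a b) (inj_eq perm_inj) eq_sym partner_neq.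
Qed.

(** Partners are uniformly distributed by symmetry: swapping [y1] and [y2] is an
    involution of [A] that exchanges the pairings where [b] is matched with
    [y1] and those where it is matched with [y2]. *)
Lemma card_partner_eq (A : {set {set {set H}}}) (Y : {set H}) b y :
    A \subset pairings ->
    {in Y &, forall y1 y2 c, c \in A -> swap y1 y2 c \in A} ->
    b \notin Y -> y \in Y ->
  #|[set c in A | partner c b == y]| * #|Y| = #|[set c in A | partner c b \in Y]|.
Proof.
move=> /subsetP AP swA bY yY; rewrite -[RHS]sum1_card.
rewrite (partition_big (fun c => partner c b) (mem Y)) /=; last first.
  by move=> c; rewrite inE => /andP[].
rewrite (eq_bigr (fun=> #|[set c in A | partner c b == y]|)).
  by rewrite sum_nat_const mulnC.
move=> z zY; rewrite sum1dep_card.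
have -> : [set c in A | partner c b == y]
          = swap y z @: [set c in A | partner c b == z].
  have sub u v : u \in Y -> v \in Y -> forall c,
      c \in [set c in A | partner c b == v] ->
      swap u v c \in [set c in A | partner c b == u].
    move=> uY vY c; rewrite !inE => /andP[cA /eqP cb].
    rewrite swA //= partner_swap ?AP //.
    have -> : tperm u v b = b by apply: tpermD; apply: contraNneq bY => <-.
    by rewrite cb tpermR.
  apply/setP=> c; apply/idP/imsetP => [cy|[c' c'z ->]]; last exact: sub.
  exists (swap z y c); first exact: sub.
  by rewrite /swap [tperm z y]tpermC -/(swap y z _) swapK.
rewrite card_imset; last exact/inv_inj/swapK.
apply: eq_card => c; rewrite !inE.
by case: eqP => [->|]; rewrite ?zY ?andbT ?andbF.
Qed.

Lemma card_partner a x : a != x ->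
  #|[set c in pairings | partner c a == x]| * (#|H| - 1) = #|pairings|.
Proof.
move=> ax; have -> : #|H| - 1 = #|[set~ a]|.
  by rewrite cardsC1 subn1.
rewrite card_partner_eq ?inE ?eqxx // 1?eq_sym //.
  apply: eq_card => c; rewrite !inE; apply: andb_idr => cP.
  exact: partner_neq.
by move=> y z _ _ c; apply: swap_pairings.
Qed.

(** Given the pair [{a, x}], the partner of [b] is uniform on the [#|H| - 3]
    half-edges that are still available. *)
Lemma card_partner2 a x b y : uniq [:: a; x; b; y] ->
  #|[set c in pairings | (partner c a == x) && (partner c b == y)]| * (#|H| - 3)
    <= #|[set c in pairings | partner c a == x]|.
Proof.
rewrite /= !inE !negb_or -!andbA => /and5P[ax ab ay xb /and3P[xy bY _]].
set A := [set c in pairings | partner c a == x].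
pose Y := ~: [set a; x; b].
have -> : #|H| - 3 = #|Y|.
  rewrite -(cardsC [set a; x; b]) -setUA !cardsU1 cards1 !inE.
  by rewrite negb_or ax ab xb /= -[1 + (1 + 1)]/3 addKn /Y -setUA.
have -> : [set c in pairings | (partner c a == x) && (partner c b == y)]
          = [set c in A | partner c b == y].
  by apply/setP => c; rewrite !inE andbA.
rewrite card_partner_eq.
- by apply/subset_leq_card/subsetP => c; rewrite inE => /andP[].
- by apply/subsetP => c; rewrite inE => /andP[].
- move=> z t; rewrite !inE !negb_or -!andbA => /and3P[za zx zb] /and3P[ta tx tb] c.
  rewrite !inE => /andP[cP /eqP ca]; rewrite swap_pairings //=.
  by rewrite partner_swap // (tpermD za ta) ca tpermD.
- by rewrite !inE eqxx !orbT.
- by rewrite !inE !negb_or eq_sym ay eq_sym xy eq_sym bY.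
Qed.

(** The expectation of a sum over the pairs; each [x != a] is the partner of [a]
    with probability [1 / (#|H| - 1)]. *)
Lemma sum_partner (f : H -> H -> nat) :
  (\sum_(c in pairings) \sum_a f a (partner c a)) * (#|H| - 1)
    = #|pairings| * \sum_a \sum_(x | x != a) f a x.
Proof.
rewrite exchange_big /= big_distrl big_distrr /=; apply: eq_bigr => a _.
rewrite (partition_big (fun c => partner c a) (fun x => x != a)) /=; last first.
  by move=> c; apply: partner_neq.
rewrite big_distrl big_distrr /=; apply: eq_bigr => x xa.
rewrite (eq_bigr (fun=> f a x)) => [|c /andP[_ /eqP->]] //.
rewrite sum_nat_cond_const mulnAC; congr (_ * _).
by rewrite -(@card_partner a x) 1?eq_sym.
Qed.

(** The corresponding bound for sums over two disjoint pairs, from which all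
    second moments are computed. *)
Lemma sum_partner2 (f : H -> H -> H -> H -> nat) :
  (\sum_(c in pairings) \sum_a \sum_(b | (b != a) && (b != partner c a))
      f a (partner c a) b (partner c b)) * ((#|H| - 1) * (#|H| - 3))
    <= #|pairings| * \sum_a \sum_x \sum_b \sum_y f a x b y.
Proof.
rewrite exchange_big /= big_distrl big_distrr /=; apply: leq_sum => a _.
pose ok x b y := uniq [:: a; x; b; y].
have -> : \sum_(c in pairings) \sum_(b | (b != a) && (b != partner c a))
             f a (partner c a) b (partner c b)
          = \sum_b \sum_(u : H * H | ok u.1 b u.2)
              #|[set c in pairings | (partner c a == u.1) && (partner c b == u.2)]|
                * f a u.1 b u.2.
  rewrite (exchange_big_dep predT) //=; apply: eq_bigr => b _.
  rewrite (partition_big (fun c => (partner c a, partner c b))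
             (fun u => ok u.1 b u.2)) /=.
    apply: eq_bigr => -[x y] /= okb; rewrite (eq_bigr (fun=> f a x b y)) /=.
      rewrite sum_nat_cond_const; congr (_ * _); apply: eq_card => c.
      rewrite !inE xpair_eqE.
      have [ba bx] : b != a /\ b != x.
        case/and3P: okb; rewrite !inE !negb_or !(eq_sym b).
        by case/and3P=> [_ -> _] /andP[->].
      by case: (partner c a =P x) => [->|_]; rewrite ba ?bx /= ?andbF ?andbT.
    by move=> c /andP[_ /eqP[<- <-]].
  move=> c /andP[cP /andP[ba bma]].
  have mba : partner c b != a by apply: contraNneq bma => <-; rewrite partnerK.
  have mab : partner c a != partner c b.
    by rewrite (inj_eq (partner_inj cP)) eq_sym.
  rewrite /ok /= !inE !negb_or ![a == _]eq_sym [_ == b]eq_sym.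
  by rewrite [b == partner c b]eq_sym !partner_neq // ba mba bma mab.
rewrite [in leqRHS]exchange_big /= big_distrl big_distrr /=; apply: leq_sum => b _.
rewrite pair_big big_distrl big_distrr /= big_mkcond /=.
apply: leq_sum => -[x y] _ /=; case: ifP => // okb.
have ax : a != x by move: okb; rewrite /ok /= !inE !negb_or => /andP[/andP[]].
rewrite -(card_partner ax) mulnAC leq_mul2r; apply/orP; right.
by rewrite mulnCA [leqRHS]mulnC leq_mul2l card_partner2 ?orbT.
Qed.

(** A pair is split off at a time, so the induction is on the half of the size
    of a subset [D]. *)
Lemma pairings_gt0 : ~~ odd #|H| -> 0 < #|pairings|.
Proof.
suff main k (D : {set H}) : #|D| = k.*2 -> exists2 c : {set {set H}},
    partition c D & forall p, p \in c -> #|p| = 2.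
  move=> evH; have [|c cP c2] := main #|H|./2 [set: H].
    by rewrite cardsT even_halfK.
  apply/card_gt0P; exists c; rewrite pairings.unlock inE cP /=.
  by apply/forall_inP => p /c2->.
elim: k D => [|k IH] D cD.
  exists set0 => [|p]; last by rewrite inE.
  by rewrite (cards0_eq cD) partition_set0.
have /card_gt0P[x xD] : 0 < #|D| by rewrite cD.
have /card_gt0P[y] : 0 < #|D :\ x| by move: cD; rewrite (cardsD1 x D) xD; lia.
rewrite !inE => /andP[yx yD].
have [|c cP c2] := IH (D :\: [set x; y]).
  move: (cardsID [set x; y] D); rewrite (setIidPr _) ?cards2 1?eq_sym ?yx ?cD.
    by rewrite doubleS add2n => -[].
  by apply/subsetP => z; rewrite !inE => /orP[]/eqP->.
exists ([set x; y] |: c); last first.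
  by move=> p; rewrite !inE => /orP[/eqP->|/c2//]; rewrite cards2 eq_sym yx.
have -> : D = [set x; y] :|: (D :\: [set x; y]).
  rewrite setDE setUIr setUCr setIT.
  apply/esym/setUidPr/subsetP=> z.
  by rewrite !inE => /orP[]/eqP->.
apply: partitionU1 => //.
- by apply/set0Pn; exists x; rewrite !inE eqxx.
- by rewrite disjoint_subset; apply/subsetP => z; rewrite !inE => ->.
Qed.

End Pairings.

(** * The upper bound: the second moment of the number of loops *)

Section Labelled.
Variables (H V : finType) (v : H -> V).
Local Notation pairings := (pairings H).
Implicit Types (c : {set {set H}}) (a b x y k : H).

(** The degree of the vertex that carries the half-edge [a], so that [deg_sum] is
    the sum of the squared degrees of the vertices. *)
Definition deg a := #|[set b | v b == v a]|.
Definition deg_sum := \sum_a deg a.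

Lemma deg_gt0 a : 0 < deg a.
Proof. by apply/card_gt0P; exists a; rewrite inE. Qed.

Lemma card_le_deg_sum : #|H| <= deg_sum.
Proof. by rewrite -sum1_card; apply: leq_sum => a _; apply: deg_gt0. Qed.

Lemma eq_deg a b : v a = v b -> deg a = deg b.
Proof. by move=> ab; rewrite /deg ab. Qed.

Lemma deg_sqr_le a : deg a ^ 2 <= deg_sum.
Proof.
rewrite /deg_sum (bigID (fun b => v b == v a)) /=.
apply: leq_trans (leq_addr _ _).
rewrite (eq_bigr (fun=> deg a)) => [|b /eqP/eq_deg //].
by rewrite sum_nat_cond_const expnS expn1 leq_mul2r /deg cardsE leqnn orbT.
Qed.

Lemma deg_mul_le a b : deg a * deg b <= deg_sum.
Proof.
have [+ _] := nat_Cauchy (deg a) (deg b).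
by have := deg_sqr_le a; have := deg_sqr_le b; move=> *; nia.
Qed.

(** Each loop is counted twice, once for each of its half-edges. *)
Definition loops c := \sum_a (v (partner c a) == v a).

Lemma sum_loops :
  (\sum_(c in pairings) loops c) * (#|H| - 1) = #|pairings| * (deg_sum - #|H|).
Proof.
rewrite (sum_partner (fun a x => v x == v a)); congr (_ * _).
apply/eqP; rewrite -(eqn_add2r #|H|) subnK ?card_le_deg_sum //; apply/eqP.
rewrite -sum1_card -big_split /=; apply: eq_bigr => a _.
by rewrite /deg card_sum_bool [RHS](bigD1 a) //= eqxx addnC.
Qed.

(** In the square of [loops], the ordered pairs of half-edges in a common loop
    contribute [2 * loops]; the others lie in disjoint pairs. *)
Lemma sum_loops_sqr_le :
  (\sum_(c in pairings) loops c ^ 2) * ((#|H| - 1) * (#|H| - 3))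
    <= 2 * (\sum_(c in pairings) loops c) * ((#|H| - 1) * (#|H| - 3))
       + #|pairings| * (deg_sum - #|H|) ^ 2.
Proof.
pose L a x : nat := (x != a) && (v x == v a).
have sumL : \sum_a \sum_x L a x = deg_sum - #|H|.
  apply/eqP; rewrite -(eqn_add2r #|H|) subnK ?card_le_deg_sum //; apply/eqP.
  rewrite -sum1_card -big_split /=; apply: eq_bigr => a _.
  rewrite /deg card_sum_bool [RHS](bigD1 a) //= eqxx (bigD1 a) //= /L eqxx.
  rewrite addnC; congr (_ + _); apply: eq_bigr => x xa.
  by rewrite xa.
have := sum_partner2 (fun a x b y => L a x * L b y).
have -> : \sum_a \sum_x \sum_b \sum_y L a x * L b y = (deg_sum - #|H|) ^ 2.
  rewrite -sumL expnS expn1 big_distrl; apply: eq_bigr => a _.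
  rewrite big_distrl; apply: eq_bigr => x _.
  rewrite big_distrr; apply: eq_bigr => b _.
  by rewrite big_distrr.
move=> le2; apply: leq_trans (leq_add (leqnn _) le2); rewrite -mulnDl leq_mul2r.
apply/orP; right; rewrite big_distrr -big_split /=; apply: leq_sum => c cP.
rewrite expnS expn1 {1}/loops big_distrl /= /loops big_distrr -big_split /=.
apply: leq_sum => a _.
rewrite (bigD1 a) //= (bigD1 (partner c a)) ?partner_neq //=.
rewrite mulnDr mulnDr addnA leq_add //.
  by rewrite partnerK //; do 2![case: eqP].
rewrite big_distrr /=; apply: leq_sum => b _.
by rewrite /L !partner_neq.
Qed.

(** Chebyshev's inequality with the denominators cleared: dividing by [l (h - 3)]
    for [h = #|H|] and [l = deg_sum - h], the proportion of loopless pairings is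
    at most [2 (h - 1) / l + 2 / (h - 3)]. *)
Lemma loopless_upper :
  #|[set c in pairings | loops c == 0]| * (deg_sum - #|H|) * (#|H| - 3)
    <= 2 * #|pairings| * ((#|H| - 1) * (#|H| - 3) + (deg_sum - #|H|)).
Proof.
set z := #|_|; set l := deg_sum - #|H|; set w := #|pairings|.
set h1 := #|H| - 1; set h3 := #|H| - 3.
have m1 : _ * h1 = w * l := sum_loops.
have m2 : _ <= _ * (h1 * h3) + w * l ^ 2 := sum_loops_sqr_le.
set A1 := \sum_(c in pairings) loops c in m1 m2.
set A2 := \sum_(c in pairings) loops c ^ 2 in m2.
(* The sum over all pairings of (h1 * loops c - l) ^ 2 is at least z * l ^ 2,
   because each loopless pairing contributes l ^ 2. *)
have cheb : z * l ^ 2 + 2 * l * h1 * A1 <= h1 ^ 2 * A2 + w * l ^ 2.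
  rewrite /z -sum1dep_card big_distrl /= big_mkcondr /= /A1 /A2 /w.
  rewrite !big_distrr /= -sum1_card big_distrl -!big_split /=.
  apply: leq_sum => c _; case: eqP => [->|_]; first by lia.
  have [+ _] := nat_Cauchy (h1 * loops c) l; rewrite expnMn; nia.
have [->|lgt0] := posnP l; first by rewrite muln0.
have [h30|h3gt0] := posnP h3; first by rewrite h30 muln0.
have h13 : h1 = h3 + 2 by rewrite /h1; move: h3gt0; rewrite /h3; lia.
rewrite -(leq_pmul2l lgt0) -(leq_add2r (w * l ^ 2 * h3)).
have le1 : (z + w) * l ^ 2 <= h1 ^ 2 * A2.
  by rewrite -(leq_add2r (w * l ^ 2)); apply: leq_trans cheb; nia.
apply: (@leq_trans (h1 ^ 2 * A2 * h3)).
  by apply: leq_trans (leq_mul le1 (leqnn h3)); nia.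
have -> : h1 ^ 2 * A2 * h3 = A2 * (h1 * h3) * h1 by lia.
apply: leq_trans (leq_mul m2 (leqnn h1)) _.
have -> : (2 * A1 * (h1 * h3) + w * l ^ 2) * h1
          = 2 * (A1 * h1) * (h1 * h3) + w * l ^ 2 * h1 by lia.
by rewrite m1 h13; lia.
Qed.

(** * Switchings *)

(** The partner of [a] may serve as [b] in the second clause, but only when the
    first clause holds as well. *)
Definition bad c a :=
  (v (partner c a) == v a) ||
  [exists b, [&& b != a, v b == v a & v (partner c b) == v (partner c a)]].

Definition num_bad c := #|[set a | bad c a]|.

(** Twice the sum, over the edges, of the product of the degrees of the two
    ends. *)
Definition deg_corr c := \sum_a deg a * deg (partner c a).

Lemma bad_partner c a : c \in pairings -> bad c (partner c a) = bad c a.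
Proof.
move=> cP; suff imp k : bad c k -> bad c (partner c k).
  by apply/idP/idP => /imp //; rewrite partnerK.
case/orP => [/eqP E|/existsP[b /and3P[bk /eqP E1 /eqP E2]]]; apply/orP.
  by left; rewrite partnerK // E.
right; apply/existsP; exists (partner c b).
by rewrite (inj_eq (partner_inj cP)) bk !partnerK // E1 E2 !eqxx.
Qed.

Lemma parallel_bad c a b : b != a -> v b = v a ->
  v (partner c b) = v (partner c a) -> bad c a.
Proof.
move=> ba E1 E2; apply/orP; right.
by apply/existsP; exists b; rewrite ba E1 E2 !eqxx.
Qed.

Definition closed_nbhd c x :=
  v x |: [set v (partner c k) | k in [set k | v k == v x]].

(** Sufficient conditions for the switching at [a] and [b] to destroy the bad
    edge of [a] without creating a bad one: the new edges, which join [b] to the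
    partner of [a] and [a] to the partner of [b], are not loops and have no
    parallel edge before the switching. That [b] is not bad ensures that they
    are not parallel to each other either. *)
Definition switchable c a b :=
  [&& bad c a, ~~ bad c b, v b \notin closed_nbhd c (partner c a)
    & v (partner c b) \notin closed_nbhd c a].

(** What remains visible of a bad edge [ax] after it has been switched away: it
    was a loop, or it was parallel to an edge that is still there. *)
Definition reaches c a x :=
  (v a == v x) || [exists k, (v k == v a) && (v (partner c k) == v x)].

Section Switch.
Variables (c : {set {set H}}) (a b : H).
Hypotheses (cP : c \in pairings) (sw : switchable c a b).
Let x := partner c a.
Let y := partner c b.
Let c' := swap a b c.

Let bad_a : bad c a. Proof. by case/and4P: sw. Qed.
Let good_b : ~~ bad c b. Proof. by case/and4P: sw. Qed.
Let good_y : ~~ bad c y. Proof. by rewrite bad_partner. Qed.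
Let vbx : v b <> v x.
Proof. by case/and4P: sw => _ _ + _ E; rewrite !inE E eqxx. Qed.
Let vya : v y <> v a.
Proof. by case/and4P: sw => _ _ _ + E; rewrite !inE -/y E eqxx. Qed.
Let nbx k : v k = v x -> v (partner c k) <> v b.
Proof.
case/and4P: sw => _ _ + _ E1 E2; rewrite !inE negb_or => /andP[_ /imsetP[]].
by exists k; rewrite ?inE ?E1.
Qed.
Let nby k : v k = v a -> v (partner c k) <> v y.
Proof.
case/and4P: sw => _ _ _ + E1 E2; rewrite !inE negb_or => /andP[_ /imsetP[]].
by exists k; rewrite ?inE ?E1.
Qed.
Let vby : v b <> v y.
Proof. by move=> E; move: good_b; rewrite /bad -/y E eqxx. Qed.
Let ba : b != a. Proof. by apply: contraNneq good_b => ->. Qed.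
Let xa : x != a. Proof. exact: partner_neq. Qed.
Let yb : y != b. Proof. exact: partner_neq. Qed.
Let bx : b != x.
Proof. by apply: contraNneq good_b => ->; rewrite bad_partner. Qed.
Let ya : y != a. Proof. by apply: contraNneq good_y => ->. Qed.
Let yx : y != x. Proof. by rewrite (inj_eq (partner_inj cP)). Qed.

Let m'a : partner c' a = y.
Proof. by rewrite partner_swap // tpermL tpermD // eq_sym. Qed.
Let m'b : partner c' b = x.
Proof. by rewrite partner_swap // tpermR tpermD // eq_sym. Qed.
Let m'x : partner c' x = b.
Proof. by rewrite -m'b partnerK // swap_pairings. Qed.
Let m'y : partner c' y = a.
Proof. by rewrite -m'a partnerK // swap_pairings. Qed.
Let m'k k : k \notin [:: a; b; x; y] -> partner c' k = partner c k.
Proof.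
rewrite !inE !negb_or => /and4P[ka kb kx ky].
rewrite partner_swap // (@tpermD _ a b k) 1?eq_sym // tpermD //.
  by apply: contraNneq kx => E; rewrite /x E partnerK.
by apply: contraNneq ky => E; rewrite /y E partnerK.
Qed.

Let switched_good_a : ~~ bad c' a.
Proof.
rewrite negb_or m'a; apply/andP; split; first exact/eqP.
apply/existsP => -[k /and3P[ka /eqP E1 /eqP E2]].
have [ks|kn] := boolP (k \in [:: a; b; x; y]); last first.
  by move: E2; rewrite m'k //; apply: nby.
move: ks; rewrite !inE (negbTE ka) /= => /or3P[]/eqP kE.
- move: good_b; rewrite (@parallel_bad c b a) // 1?eq_sym -?E1 ?kE //.
  by rewrite -/x -/y -E2 kE m'b.
- by move: E2; rewrite kE m'x => /vby.
- by move: E1; rewrite kE.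
Qed.

Let switched_good_x : ~~ bad c' x.
Proof.
rewrite negb_or m'x; apply/andP; split; first exact/eqP.
apply/existsP => -[k /and3P[kx /eqP E1 /eqP E2]].
have [ks|kn] := boolP (k \in [:: a; b; x; y]); last first.
  by move: E2; rewrite m'k //; apply: nbx.
move: ks; rewrite !inE (negbTE kx) /= => /or3P[]/eqP kE.
- by move: E2; rewrite kE m'a => /esym/vby.
- by move: E1; rewrite kE => /vbx.
- move: good_b; rewrite (@parallel_bad c b a) // 1?eq_sym //.
    by rewrite -E2 kE m'y.
  by rewrite -/x -/y -E1 kE.
Qed.

Let switched_good k : k \in [:: a; b; x; y] -> ~~ bad c' k.
Proof.
have c'P : c' \in pairings by rewrite swap_pairings.
rewrite !inE => /or4P[]/eqP-> //; last by rewrite -m'a bad_partner.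
by rewrite -m'x bad_partner.
Qed.

(** The four half-edges involved are no longer bad, although [a] was; any other
    half-edge keeps its partner, and a parallel edge that makes it bad cannot be
    a new one, because that one would then be bad too. *)
Lemma num_bad_switch : num_bad c' < num_bad c.
Proof.
apply/proper_card/properP; split; last by exists a; rewrite !inE.
apply/subsetP => k; rewrite !inE => bk.
have kn : k \notin [:: a; b; x; y] by apply: contraL bk; apply: switched_good.
move: bk => /orP[|/existsP[l /and3P[lk /eqP E1 /eqP E2]]].
  by rewrite m'k // => kk; rewrite /bad kk.
have ln : l \notin [:: a; b; x; y].
  apply/negP => /switched_good /negP; apply; apply: (@parallel_bad _ _ k) => //.
  by rewrite eq_sym.
by apply: (@parallel_bad _ _ l) => //; rewrite -(m'k ln) -(m'k kn).
Qed.

(** Only the four terms of the half-edges involved change, and a product of two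
    degrees is at most the sum of the squared degrees. *)
Lemma deg_corr_switch : deg_corr c' <= deg_corr c + 4 * deg_sum.
Proof.
rewrite /deg_corr (bigID (mem [:: a; b; x; y])) /= addnC leq_add //.
  rewrite (eq_bigr (fun k => deg k * deg (partner c k))) => [|k /m'k-> //].
  by rewrite [leqRHS](bigID (mem [:: a; b; x; y])) /= leq_addl.
apply: (@leq_trans (\sum_(k in [:: a; b; x; y]) deg_sum)).
  by apply: leq_sum => k _; apply: deg_mul_le.
rewrite sum_nat_cond_const leq_mul2r; apply/orP; right.
by rewrite cardsE; apply: (card_size [:: a; b; x; y]).
Qed.

(** The new partner of [b] is the old partner of [a]; since [b] was not bad, the
    edge parallel to that of [a] is not affected by the switching. *)
Lemma switch_inverse : reaches c' a (partner c' b).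
Proof.
rewrite m'b /reaches; have := bad_a; rewrite /bad eq_sym.
case: (v a =P v x) => //= nax.
case/existsP => k /and3P[ka /eqP E1 /eqP E2]; apply/existsP; exists k.
suff kn : k \notin [:: a; b; x; y] by rewrite m'k // E1 E2 !eqxx.
rewrite !inE !negb_or ka /=; apply/and3P; split.
- apply: contraNneq good_b => kE; apply: (@parallel_bad _ _ a).
  + by rewrite -kE eq_sym.
  + by rewrite -kE E1.
  + by rewrite -kE E2.
- by apply/eqP => kE; apply: nax; rewrite -E1 kE.
- by apply/eqP => kE; apply: vya; rewrite -E1 kE.
Qed.

End Switch.

(** * Counting switchings *)

Definition card_over (W : {set V}) := #|[set b | v b \in W]|.

Lemma card_over_sqr W : card_over W ^ 2 <= #|W| * deg_sum.
Proof.
pose f w := #|[set b | v b == w]|.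
have -> : card_over W = \sum_(w in W) f w.
  rewrite /card_over -sum1dep_card (partition_big v (mem W)) //=.
  apply: eq_bigr => w wW; rewrite /f -sum1dep_card; apply: eq_bigl => b.
  by case: eqP => [->|]; rewrite ?wW ?andbF.
have -> : deg_sum = \sum_w f w ^ 2.
  rewrite /deg_sum (partition_big v predT) //=; apply: eq_bigr => w _.
  rewrite (eq_bigr (fun=> f w)) => [|b /eqP <- //].
  by rewrite sum_nat_cond_const expnS expn1.
apply: leq_trans (sqr_sum_le W f) _; rewrite leq_mul2l; apply/orP; right.
by rewrite [leqRHS](bigID (mem W)) /= leq_addr.
Qed.

(** A vertex of degree [D] and its neighbours are at most [1 + D <= 2 D] vertices;
    by Cauchy-Schwarz they carry at most [sqrt (2 D S)] half-edges, where
    [S = deg_sum] and [D <= sqrt S]: this is of order [S ^ (3/4)], hence small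
    compared with [N] when [S = O(N)]. *)
Lemma card_over_nbhd c x : card_over (closed_nbhd c x) ^ 4 <= 4 * deg_sum ^ 3.
Proof.
have cardW : #|closed_nbhd c x| <= 2 * deg x.
  rewrite /closed_nbhd; apply: leq_trans (_ : 1 + deg x <= _).
    rewrite cardsU1 leq_add ?leq_b1 //; exact: leq_imset_card.
  by have := deg_gt0 x; lia.
have le2 : card_over (closed_nbhd c x) ^ 2 <= 2 * deg x * deg_sum.
  by apply: leq_trans (card_over_sqr _) _; rewrite leq_mul2r cardW orbT.
rewrite (expnM _ 2 2); apply: leq_trans (_ : (2 * deg x * deg_sum) ^ 2 <= _).
  by rewrite leq_exp2r.
rewrite !expnMn [_ ^ 3]expnS mulnA leq_mul2r; apply/orP; right.
by rewrite leq_mul2l deg_sqr_le orbT.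
Qed.

(** At most [N / 2] half-edges are bad, and each of the two other conditions
    excludes at most [N / 4] half-edges. *)
Lemma card_switchable (N C : nat) c a :
  c \in pairings -> #|H| = 2 * N -> deg_sum <= C * N -> 1024 * C ^ 3 <= N ->
  2 * num_bad c <= N -> bad c a ->
  N <= #|[set b | switchable c a b]|.
Proof.
move=> cP cH SC CN bN ba.
have over k : 4 * card_over (closed_nbhd c k) <= N.
  rewrite -(@leq_exp2r _ _ 4) // expnMn.
  have := card_over_nbhd c k.
  have : deg_sum ^ 3 <= (C * N) ^ 3 by rewrite leq_exp2r.
  rewrite expnMn => le1 le2.
  have le3 : 1024 * C ^ 3 * N ^ 3 <= N * N ^ 3 by rewrite leq_mul2r CN orbT.
  rewrite -expnS in le3; apply: leq_trans le3.
  by rewrite -[4 ^ 4]/(256); lia.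
have o1 := over (partner c a); have o2 := over a.
have oE : card_over (closed_nbhd c a)
          = #|[set b | v (partner c b) \in closed_nbhd c a]|.
  rewrite /card_over -[RHS](card_imset _ (partner_inj cP)).
  apply: eq_card => k; rewrite inE.
  apply/idP/imsetP => [kW|[l + ->]]; last by rewrite inE.
  by exists (partner c k); rewrite 1?inE partnerK.
rewrite oE in o2.
have := cardsC [set b | switchable c a b].
suff : #|~: [set b | switchable c a b]| <= N by rewrite cH; lia.
apply: (@leq_trans #|[set b | bad c b]
   :|: [set b | v b \in closed_nbhd c (partner c a)]
   :|: [set b | v (partner c b) \in closed_nbhd c a]|).
  apply/subset_leq_card/subsetP => b; rewrite /switchable ba.
  move: (closed_nbhd c a) (closed_nbhd c (partner c a)) => Wa Wx.
  by rewrite !inE /= !negb_and !negbK orbA.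
have leU (P Q : {set H}) : #|P :|: Q| <= #|P| + #|Q|.
  by have [] := leq_card_setU P Q.
apply: leq_trans (leU _ _) _.
have := leU [set b | bad c b] [set b | v b \in closed_nbhd c (partner c a)].
by move: bN o1 o2; rewrite /num_bad /card_over; lia.
Qed.

(** Sum over the edge that witnesses [reaches], by its half-edge [k]: there are
    [deg k * deg (partner c k)] pairs with the same two ends. *)
Lemma reaches_count c : c \in pairings ->
  \sum_a \sum_b reaches c a (partner c b) <= deg_sum + deg_corr c.
Proof.
move=> cP.
have -> : \sum_a \sum_b reaches c a (partner c b) = \sum_a \sum_x reaches c a x.
  apply: eq_bigr => a _; rewrite [RHS](reindex_inj (partner_inj cP)) /=.
  by [].
apply: (@leq_trans (\sum_a \sum_x ((v x == v a) +
    \sum_k ((v a == v k) && (v x == v (partner c k)))))).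
  apply: leq_sum => a _; apply: leq_sum => x _.
  rewrite /reaches [v a == v x]eq_sym.
  case: eqP => //= _; case: existsP => //= -[k /andP[E1 E2]].
  by rewrite (bigD1 k) //= [v a == _]eq_sym E1 [v x == _]eq_sym E2.
under eq_bigr do rewrite big_split /=.
rewrite big_split /= leq_add //.
  by apply: leq_sum => a _; rewrite /deg card_sum_bool.
under eq_bigr do rewrite exchange_big.
rewrite exchange_big; apply: leq_sum => k _ /=.
rewrite /deg !card_sum_bool big_distrl leq_sum //= => a _.
by rewrite big_distrr leq_sum //= => x _; rewrite mulnb.
Qed.

(** The weight [4 * deg_sum] bounds the increase of [deg_corr] in a switching, so
    the loss of one bad half-edge makes up for it. *)
Definition potential c := deg_corr c + 4 * deg_sum * num_bad c.

Lemma potential_switch c a b : c \in pairings -> switchable c a b ->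
  potential (swap a b c) <= potential c.
Proof.
move=> cP sw; have := deg_corr_switch a b cP; have := num_bad_switch cP sw.
by rewrite /potential => *; nia.
Qed.

Definition tame q j := [set c in pairings | (potential c <= q) && (num_bad c <= j)].

(** Double counting of the switchings from the pairings with exactly [j + 1] bad
    half-edges: at least [N] leave each of those, and at most [deg_sum + q]
    reach each pairing with fewer. *)
Lemma tame_step (N C q j : nat) :
  #|H| = 2 * N -> deg_sum <= C * N -> 1024 * C ^ 3 <= N -> 2 * j.+1 <= N ->
  N * #|tame q j.+1| <= (N + (deg_sum + q)) * #|tame q j|.
Proof.
move=> cH SC CN jN.
pose A := [set c in tame q j.+1 | num_bad c == j.+1].
have cA : #|tame q j.+1| = #|A| + #|tame q j|.
  rewrite -(cardsID [set c | num_bad c == j.+1] (tame q j.+1)); congr (_ + _).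
    by apply: eq_card => c; rewrite !inE.
  apply: eq_card => c; rewrite !inE.
  by case: (c \in _) => //=; case: (_ <= q) => //=; lia.
rewrite cA mulnDr mulnDl addnC leq_add2l.
apply: (@leq_trans (\sum_(c in A) \sum_a \sum_b switchable c a b)).
  rewrite mulnC -sum_nat_const; apply: leq_sum => c.
  rewrite !inE => /andP[/and3P[cP _ _] /eqP nb].
  have /card_gt0P[a] : 0 < num_bad c by rewrite nb.
  rewrite inE => ba; rewrite (bigD1 a) //= -card_sum_bool.
  apply: leq_trans (leq_addr _ _); apply: card_switchable CN _ ba => //.
  by rewrite nb.
apply: (@leq_trans (\sum_(c in tame q j) \sum_a \sum_b reaches c a (partner c b))).
  rewrite exchange_big [leqRHS]exchange_big; apply: leq_sum => a _ /=.
  rewrite exchange_big [leqRHS]exchange_big; apply: leq_sum => b _ /=.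
  rewrite -!big_mkcondr /= !sum1dep_card.
  (* For fixed a and b, the switching is injective. *)
  rewrite -(card_imset _ (inv_inj (swapK a b))).
  apply/subset_leq_card/subsetP => _ /imsetP[c + ->].
  rewrite !inE => /andP[/andP[/and3P[cP pq _] /eqP nb] sw].
  have c'P := swap_pairings a b cP.
  rewrite c'P (leq_trans (potential_switch cP sw) pq) /=.
  rewrite -ltnS -nb (num_bad_switch cP sw) /=.
  exact: switch_inverse.
rewrite mulnC -sum_nat_const; apply: leq_sum => c; rewrite inE => /and3P[cP pq _].
apply: leq_trans (reaches_count cP) _; rewrite leq_add2l.
by apply: leq_trans pq; apply: leq_addr.
Qed.

(** * The lower bound *)

Lemma sum_deg_corr_le : (\sum_(c in pairings) deg_corr c) * (#|H| - 1)
  <= #|pairings| * deg_sum ^ 2.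
Proof.
rewrite (sum_partner (fun a x => deg a * deg x)) leq_mul2l; apply/orP; right.
rewrite expnS expn1 {1}/deg_sum big_distrl leq_sum //= => a _.
rewrite big_distrr [leqRHS](bigID (fun x => x != a)) /=; exact: leq_addr.
Qed.

Definition num_parallel c :=
  \sum_a \sum_(b | (b != a) && (b != partner c a))
     ((v b == v a) && (v (partner c b) == v (partner c a))).

Lemma sum_num_parallel :
  (\sum_(c in pairings) num_parallel c) * ((#|H| - 1) * (#|H| - 3))
    <= #|pairings| * deg_sum ^ 2.
Proof.
apply: leq_trans (sum_partner2 (fun a x b y => (v b == v a) && (v y == v x))) _.
rewrite leq_mul2l; apply/orP; right.
rewrite expnS expn1 big_distrl leq_sum //= => a _.
rewrite big_distrr leq_sum //= => x _; rewrite /deg !card_sum_bool big_distrl.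
by apply: leq_sum => b _; rewrite big_distrr leq_sum //= => y _; rewrite mulnb.
Qed.

Lemma num_bad_le c : num_bad c <= loops c + num_parallel c.
Proof.
rewrite /num_bad card_sum_bool -big_split leq_sum //= => a _; rewrite /bad.
case: eqP => //= nl; case: existsP => //= -[b /and3P[ba /eqP E1 /eqP E2]].
rewrite (bigD1 b) /= ?E1 ?E2 ?eqxx // ba; apply/eqP => bE; apply: nl.
by rewrite -bE E1.
Qed.

(** With [M = 5 C + 4 C ^ 2], the average of [potential] is at most [S M], so at
    least half of the pairings have potential at most [q = 2 S M], by Markov's
    inequality. Such pairings have at most [M / 2 <= M] bad half-edges, and
    each of [M] applications of [tame_step] costs a factor
    [K >= (N + S + q) / N]. *)
Lemma good_lower (N C : nat) :
  #|H| = 2 * N -> deg_sum <= C * N -> 1024 * C ^ 3 <= N ->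
  2 * (5 * C + 4 * C ^ 2) <= N -> 3 <= N ->
  #|pairings| <= 2 * (1 + C + 10 * C ^ 2 + 8 * C ^ 3) ^ (5 * C + 4 * C ^ 2)
                   * #|[set c in pairings | num_bad c == 0]|.
Proof.
move=> cH SC CN MN N3; set M := 5 * C + 4 * C ^ 2.
set S := deg_sum in SC *; set w := #|pairings|; set K := _ + 8 * C ^ 3.
have Sgt0 : 0 < S by apply: leq_trans card_le_deg_sum; rewrite cH; lia.
have Cgt0 : 0 < C by case: (C) SC => //; rewrite leqNgt Sgt0.
have Ngt0 : 0 < N by lia.
have corr : \sum_(c in pairings) deg_corr c <= w * (C * S).
  rewrite -(leq_pmul2r Ngt0); apply: (@leq_trans (w * S ^ 2)); last by nia.
  apply: leq_trans sum_deg_corr_le; rewrite leq_mul2l cH; apply/orP; right; lia.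
have loop : \sum_(c in pairings) loops c <= w * C.
  rewrite -(leq_pmul2r Ngt0); apply: (@leq_trans (w * S)); last by nia.
  apply: (@leq_trans (w * (S - #|H|))); last by rewrite leq_mul2l leq_subr orbT.
  rewrite -sum_loops leq_mul2l cH; apply/orP; right; lia.
have par : \sum_(c in pairings) num_parallel c <= w * C ^ 2.
  rewrite -(@leq_pmul2r (N ^ 2)) ?expn_gt0 ?Ngt0 //.
  apply: (@leq_trans (w * S ^ 2)); last first.
    by rewrite -mulnA -expnMn leq_mul2l leq_exp2r // SC orbT.
  apply: leq_trans sum_num_parallel; rewrite leq_mul2l cH; apply/orP; right; nia.
have sumpot : \sum_(c in pairings) potential c <= w * (S * M).
  rewrite /potential big_split -big_distrr /=.
  have : \sum_(c in pairings) num_bad c <= w * C + w * C ^ 2.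
    apply: leq_trans (leq_add loop par); rewrite -big_split leq_sum //= => c _.
    exact: num_bad_le.
  rewrite -/S => /(leq_mul (leqnn (4 * S)))/(leq_add corr)/leq_trans; apply.
  by rewrite /M; lia.
pose q := 2 * (S * M).
have qgt0 : 0 < S * M by rewrite muln_gt0 Sgt0 /M; lia.
have tameM : w <= 2 * #|tame q M|.
  have : #|[set c in pairings | q < potential c]| * 2 <= w.
    rewrite -(leq_pmul2r qgt0) -mulnA -/q.
    apply: leq_trans sumpot; rewrite -sum_nat_const.
    rewrite [leqRHS](bigID (fun c => q < potential c)) /=.
    apply: leq_trans (leq_addr _ _).
    rewrite (eq_bigl (fun c => (c \in pairings) && (q < potential c))).
      by apply: leq_sum => c /andP[_ /ltnW].
    by move=> c; rewrite !inE.
  have := cardsID [set c | q < potential c] pairings.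
  have -> : pairings :&: [set c | q < potential c]
            = [set c in pairings | q < potential c].
    by apply/setP => c; rewrite !inE.
  have -> : pairings :\: [set c | q < potential c] = tame q M.
    apply/setP => c; rewrite !inE -leqNgt andbC; case: (c \in _) => //=.
    case: leqP => //= pq; apply/esym; rewrite -(leq_pmul2l Sgt0).
    by move: pq; rewrite /potential /q -/S; lia.
  rewrite -/w => <-; rewrite muln2 -addnn leq_add2l => le.
  by rewrite mul2n -addnn leq_add2r.
have chain j : j <= M -> #|tame q j| <= K ^ j * #|tame q 0|.
  elim: j => [|j IH] jM; first by rewrite mul1n.
  rewrite expnS -mulnA; apply: leq_trans (leq_mul (leqnn K) (IH (ltnW jM))).
  rewrite -(leq_pmul2l Ngt0).
  apply: leq_trans (tame_step q cH SC CN _) _; first by lia.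
  rewrite mulnA leq_mul2r; apply/orP; right; rewrite /K /q -/S.
  by have := leq_mul (leqnn (1 + 2 * M)) SC; rewrite /M; lia.
apply: leq_trans tameM _; rewrite -mulnA leq_mul2l /=.
apply: leq_trans (chain M (leqnn M)) _; rewrite leq_mul2l; apply/orP; right.
by apply/subset_leq_card/subsetP => c; rewrite !inE leqn0 => /and3P[-> _ ->].
Qed.

End Labelled.

(** * The configuration model *)

Section ConfigurationGraph.
Variables (n : nat) (d : 'I_n -> nat).
Local Notation vtx := (@vertex_of n d).
Implicit Type c : {set {set half_edge d}}.

Lemma sum_half_edge (F : 'I_n -> nat) :
  \sum_(x : half_edge d) F (vtx x) = \sum_i d i * F i.
Proof.
transitivity (\sum_(x : {i : 'I_n & 'I_(d i)} | true && true) F (tag x)) => //.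
rewrite -(sig_big_dep (fun=> true) (fun _ _ => true) (fun i _ => F i)).
by apply: eq_bigr => i _; rewrite sum_nat_const card_ord.
Qed.

Lemma card_half_edge : #|half_edge d| = \sum_i d i.
Proof.
rewrite -sum1_card (sum_half_edge (fun=> 1)).
by apply: eq_bigr => i _; rewrite muln1.
Qed.

Lemma deg_vertex_of x : deg vtx x = d (vtx x).
Proof.
rewrite /deg card_sum_bool (sum_half_edge (fun i => i == vtx x)).
rewrite (bigD1 (vtx x)) //= eqxx muln1 big1 ?addn0 // => i /negPf->.
by rewrite muln0.
Qed.

Lemma deg_sum_vertex_of : deg_sum vtx = \sum_i d i ^ 2.
Proof.
rewrite /deg_sum; under eq_bigr do rewrite deg_vertex_of.
by rewrite sum_half_edge; apply: eq_bigr => i _; rewrite expnS expn1.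
Qed.

Lemma configurationsE : configurations d = pairings (half_edge d).
Proof. by rewrite pairings.unlock. Qed.

Lemma imset_ends x y : [set vtx z | z in [set x; y]] = [set vtx x; vtx y].
Proof. by rewrite imsetU1 imset_set1. Qed.

Lemma simple_loops c : c \in pairings (half_edge d) ->
  simple (config_graph c) -> loops vtx c = 0.
Proof.
move=> cP /andP[/forallP noloop _]; apply: big1 => a _.
case: eqP => // E; have := noloop (vtx a); rewrite /= /config_mult cards_eq0.
move=> /eqP/setP/(_ [set a; partner c a]).
by rewrite !inE partner_mem // imset_ends E eqxx.
Qed.

Lemma simple_of_good c : c \in pairings (half_edge d) ->
  num_bad vtx c = 0 -> simple (config_graph c).
Proof.
move=> cP /eqP; rewrite cards_eq0 => /eqP/setP good.
have nb a : ~~ bad vtx c a by have := good a; rewrite !inE => ->.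
(* A pair whose ends are u and w can be listed from its end at u, even if
   u = w. *)
have ends (p : {set half_edge d}) u w :
    p \in c -> [set vtx z | z in p] = [set u; w] ->
    exists a, [/\ p = [set a; partner c a], vtx a = u & vtx (partner c a) = w].
  move=> pc pE.
  have /imsetP[a ap ua] : u \in [set vtx z | z in p] by rewrite pE set21.
  have [_ paE] := pair_partner cP pc ap; exists a; split=> //.
  have := set22 u w; rewrite -pE paE imset_ends !inE => /orP[/eqP wa|/eqP-> //].
  have := set22 (vtx a) (vtx (partner c a)).
  by rewrite -imset_ends -paE pE wa ua !inE orbb => /eqP.
apply/andP; split; apply/forallP => u.
  rewrite cards_eq0; apply/eqP/setP => p; rewrite !inE; apply/negbTE/negP.
  case/andP=> pc /eqP /(ends _ _ _ pc)[a [_ au mau]].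
  by have := nb a; rewrite /bad au mau eqxx.
apply/forallP => w; apply/card_le1_eqP => p q.
rewrite !inE => /andP[pc /eqP /(ends _ _ _ pc)[a [-> au aw]]].
case/andP => qc /eqP /(ends _ _ _ qc)[b [-> bu bw]].
suff -> : a = b by [].
apply/eqP; apply: contraT => ab; have := nb b.
by rewrite (@parallel_bad _ _ _ _ _ a) ?au ?aw ?bu ?bw.
Qed.

Hypothesis even_sum : ~~ odd (\sum_i d i).

Lemma card_half_edge_even : #|half_edge d| = 2 * num_edges d.
Proof. by rewrite card_half_edge /num_edges mul2n even_halfK. Qed.

Lemma configurations_gt0 : 0 < #|configurations d|.
Proof. by rewrite configurationsE pairings_gt0 // card_half_edge. Qed.

Lemma card_simple_le m :
  4 * m <= num_edges d ->
  (8 * m + 2) * num_edges d <= \sum_i d i ^ 2 ->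
  m * #|[set c in configurations d | simple (config_graph c)]|
    <= #|configurations d|.
Proof.
move=> mN SN; have := loopless_upper vtx.
rewrite deg_sum_vertex_of card_half_edge_even configurationsE.
set w := #|pairings _|; set z := #|_|; set z' := #|_|.
have zz : z' <= z.
  apply/subset_leq_card/subsetP => c; rewrite !inE.
  by case/andP=> cP /(simple_loops cP) ->; rewrite cP.
set l := _ - 2 * _; set h3 := _ - 3.
have [->//|mgt0] := posnP m.
have h3gt0 : 0 < h3 by rewrite /h3; lia.
have lgt : 8 * m * num_edges d <= l by rewrite /l; lia.
have lgt0 : 0 < l by apply: leq_trans lgt; rewrite !muln_gt0 mgt0; lia.
(* As l >= 8 m N and h3 >= 4 m, each of the two terms of the bound is at most
   l * h3 / (2 m) times the number of configurations. *)
move=> le; rewrite -(@leq_pmul2r (l * h3)) ?muln_gt0 ?lgt0 //.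
apply: (@leq_trans (m * (2 * w * ((2 * num_edges d - 1) * h3 + l)))).
  rewrite -mulnA leq_mul2l; apply/orP; right; apply: leq_trans le.
  by rewrite mulnA !leq_mul2r zz !orbT.
apply: (@leq_trans (w * ((4 * m * num_edges d) * h3 + 2 * m * l))).
  have le2N : (2 * num_edges d - 1) * h3 <= 2 * num_edges d * h3.
    by rewrite leq_mul2r leq_subr orbT.
  have := leq_mul (leqnn (2 * w)) (leq_add le2N (leqnn l)).
  by move/(leq_mul (leqnn m))/leq_trans; apply; lia.
rewrite leq_mul2l; apply/orP; right.
have le1 := leq_mul lgt (leqnn h3).
have le2 : 4 * m * l <= h3 * l.
  by rewrite leq_mul2r; apply/orP; right; rewrite /h3; lia.
by rewrite [h3 * l]mulnC in le2; lia.
Qed.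

Lemma card_simple_ge C :
  1024 * C ^ 3 <= num_edges d -> 2 * (5 * C + 4 * C ^ 2) <= num_edges d ->
  3 <= num_edges d -> \sum_i d i ^ 2 <= C * num_edges d ->
  #|configurations d|
    <= 2 * (1 + C + 10 * C ^ 2 + 8 * C ^ 3) ^ (5 * C + 4 * C ^ 2)
    * #|[set c in configurations d | simple (config_graph c)]|.
Proof.
rewrite -deg_sum_vertex_of configurationsE => CN MN N3 SC.
apply: leq_trans (good_lower card_half_edge_even SC CN MN N3) _.
rewrite leq_mul2l; apply/orP; right; apply/subset_leq_card/subsetP => c.
by rewrite !inE => /andP[cP /eqP/(simple_of_good cP) ->]; rewrite cP.
Qed.

Local Open Scope ring_scope.

Lemma Pr_simple_le (R : realType) (m : nat) : (0 < m)%N ->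
  (4 * m <= num_edges d)%N ->
  ((8 * m + 2) * num_edges d <= \sum_i d i ^ 2)%N ->
  Pr_Gstar d R (@simple 'I_n) <= m%:R^-1.
Proof.
move=> m0 mN SN; rewrite /Pr_Gstar ler_pdivrMr ?ltr0n ?configurations_gt0 //.
by rewrite ler_pdivlMl ?ltr0n // -natrM ler_nat card_simple_le.
Qed.

Lemma Pr_simple_itv (R : realType) : 0 <= Pr_Gstar d R (@simple 'I_n) <= 1.
Proof.
rewrite /Pr_Gstar divr_ge0 ?ler0n //= ler_pdivrMr ?ltr0n ?configurations_gt0 //.
rewrite mul1r ler_nat; apply/subset_leq_card/subsetP => c.
by rewrite inE => /andP[].
Qed.

End ConfigurationGraph.

Local Open Scope classical_set_scope.
Local Open Scope ring_scope.

Lemma Pr_simple_ge (R : realType) (C : nat) :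
  exists (e : R) (N0 : nat), 0 < e /\ forall (n : nat) (d : 'I_n -> nat),
    ~~ odd (\sum_i d i)%N -> (N0 <= num_edges d)%N ->
    (\sum_i d i ^ 2 <= C * num_edges d)%N -> e <= Pr_Gstar d R (@simple 'I_n).
Proof.
pose M := (5 * C + 4 * C ^ 2)%N; pose K := (1 + C + 10 * C ^ 2 + 8 * C ^ 3)%N.
have L0 : (0 < 2 * K ^ M)%N by rewrite muln_gt0 expn_gt0.
exists (2 * K ^ M)%N%:R^-1, (1024 * C ^ 3 + 2 * M + 3)%N.
split=> [|n d ev N0 SC]; first by rewrite invr_gt0 ltr0n.
rewrite /Pr_Gstar ler_pdivlMr ?ltr0n ?configurations_gt0 //.
rewrite ler_pdivrMl ?ltr0n // -natrM ler_nat.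
by apply: card_simple_ge => //; move: N0; rewrite /M; lia.
Qed.

(** * Limits *)

Lemma limn_inf_gt0 (R : realType) (u : nat -> R) :
  (forall k, 0 <= u k <= 1) ->
  0 < limn_inf u <-> exists2 e, 0 < e & \forall k \near \oo, e <= u k.
Proof.
move=> u01.
have ub : bounded_fun (u : R^o^nat).
  exists 1; split; first exact: num_real.
  move=> M M1 k _ /=; have /andP[u0 u1] := u01 k.
  by rewrite ger0_norm // (le_trans u1) // ltW.
rewrite limn_infE //; split=> [/sup_gt[]|[e e0 [k _ ek]]].
- by exists (infs u 0%N); exists 0%N.
- move=> _ [k _ <-] infk0; exists (infs u k) => //.
  exists k => // j /= kj; apply: ge_inf; last by exists j.
  by exists 0 => _ [i _ <-]; have /andP[] := u01 i.
- apply: (@lt_le_trans _ _ (infs u k)).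
    apply: (lt_le_trans e0); apply: lb_le_inf.
      by exists (u k); exists k => /=.
    by move=> _ [j /= kj <-]; apply: ek.
  apply: ub_le_sup; last by exists k.
  exact: bounded_fun_has_ubound_infs.
Qed.

Theorem theorem1p1 (R : realType) (n : nat -> nat)
    (d : forall nu : nat, 'I_(n nu) -> nat)
    (n_ge1 : forall nu, (1 <= n nu)%N)
    (even_sum : forall nu, ~~ odd (\sum_(i < n nu) d nu i)%N)
    (N_oo : (fun nu => num_edges (d nu)) @ \oo --> \oo) :
  (0 < limn_inf (fun nu => Pr_Gstar (d nu) R (@simple 'I_(n nu)))
   <-> (fun nu => (\sum_(i < n nu) d nu i ^ 2)%N%:R : R)
         =O_\oo (fun nu => (num_edges (d nu))%:R : R))
  /\
  ((fun nu => Pr_Gstar (d nu) R (@simple 'I_(n nu))) @ \oo --> (0 : R)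
   <-> (fun nu => (\sum_(i < n nu) d nu i ^ 2)%N%:R
                    / (num_edges (d nu))%:R : R) @ \oo --> +oo).
Proof.
have N_ge := (cvgnyPge _).1 N_oo.
have pr01 nu := Pr_simple_itv (even_sum nu) R.
have inv_lt (e : R) : 0 < e -> exists2 m : nat, (0 < m)%N & m%:R^-1 < e.
  move=> e0; exists (Num.truncn e^-1).+1 => //.
  by rewrite invf_plt ?posrE // truncnS_gt.
split; first (rewrite limn_inf_gt0 //;
  split=> [[e e0 near_e]|/eqO_exP[C C0 near_C]]).
- have [m m0 me] := inv_lt e e0.
  apply/eqO_exP; exists (8 * m + 2)%N%:R; first by rewrite ltr0n; lia.
  near=> nu; rewrite !ger0_norm // -natrM ler_nat leqNgt; apply/negP => lt.
  (* The upper bound would make the probability smaller than e. *)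
  suff : Pr_Gstar (d nu) R (@simple 'I_(n nu)) < e.
    by apply/negP; rewrite -leNgt; near: nu.
  apply: le_lt_trans me; apply: Pr_simple_le => //; last exact: ltnW.
  by near: nu; apply: N_ge.
- have [e [N0 [e0 le_e]]] := Pr_simple_ge R (Num.truncn C).+1.
  exists e => //; near=> nu; apply: le_e => //; first by near: nu; apply: N_ge.
  rewrite -(ler_nat R) natrM; apply: (@le_trans _ _ (C * (num_edges (d nu))%:R)).
    have : `|(\sum_(i < n nu) d nu i ^ 2)%N%:R : R|
             <= C * `|(num_edges (d nu))%:R : R|.
      by near: nu.
    by rewrite !ger0_norm.
  by rewrite ler_wpM2r // ltW // truncnS_gt.
split=> [/cvgr0Pnorm_lt to0|/cvgryPge tooo].
- apply/cvgryPge => A.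
  have [e [N0 [e0 le_e]]] := Pr_simple_ge R (Num.truncn A).+1.
  near=> nu.
  have Ngt0 : (0 < num_edges (d nu))%N by near: nu; apply: N_ge.
  have lt_e : `|Pr_Gstar (d nu) R (@simple 'I_(n nu))| < e.
    by near: nu; apply: to0.
  rewrite ler_pdivlMr ?ltr0n //.
  apply: (@le_trans _ _ ((Num.truncn A).+1 * num_edges (d nu))%N%:R).
    by rewrite natrM ler_wpM2r // ltW // truncnS_gt.
  rewrite ler_nat ltnW // ltnNge; apply/negP => SC.
  have := le_e _ _ (even_sum nu) _ SC; have /andP[pr0 _] := pr01 nu.
  rewrite ger0_norm // in lt_e; rewrite leNgt lt_e => /(_ _)/negP; apply=> //.
  by near: nu; apply: N_ge.
- apply/cvgr0Pnorm_lt => e e0; have [m m0 me] := inv_lt e e0; near=> nu.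
  have /andP[pr0 _] := pr01 nu; rewrite ger0_norm //; apply: le_lt_trans me.
  have Ngt0 : (0 < num_edges (d nu))%N by near: nu; apply: N_ge.
  apply: Pr_simple_le => //; first by near: nu; apply: N_ge.
  rewrite -(ler_nat R) natrM -ler_pdivlMr ?ltr0n //.
  by near: nu; apply: tooo.
Unshelve. all: by end_near.
Qed.
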